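(* Let $\mu>0$ and let $(\Sigma_1^*,\tau_1^* )$ with $0<|\Sigma_1^*|<|\Omega|$ be a solution of the T-ROF model with $K=2$ phases, and let $m_0^*={\rm mean}_f(\Omega\setminus\Sigma_1^* )$, $m_1^*={\rm mean}_f(\Sigma_1^* )$. Then $(\Sigma_1^*,m_0^*,m_1^* )$ is a partial minimizer of the functional $E_{\rm CV}$ with parameter $\lambda:=\frac{\mu}{2(m_1^*-m_0^* )}$.
   Context: Throughout, $\Omega\subset\mathbb R^2$ is a bounded open set with Lipschitz boundary and $f:\Omega\to[0,1]$ is a given (measurable) image. $|A|$ is Lebesgue measure; sets are Lebesgue measurable and considered up to measure zero. ${\rm Per}(A;\Omega):=TV(\chi_A)$, where $TV(u)=\sup\{\int_\Omega u\,{\rm div}\varphi\,dx:\varphi\in C_c^1(\Omega,\mathbb R^2),\|\varphi\|_\infty\le1\}$. ${\rm mean}_f(A):=\frac1{|A|}\int_A f\,dx$ if $|A|>0$ and $0$ otherwise. T-ROF model for $K=2$: a pair $(\Sigma_1^*,\tau_1^* )$, with $\Sigma_1^*\subseteq\Omega$ and $\tau_1^*$ a real threshold (in $(0,1)$), is a solution if (1) $\Sigma_1^*$ minimizes $\Sigma\mapsto {\rm Per}(\Sigma;\Omega)+\mu\int_\Sigma(\tau_1^*-f)\,dx$ over all measurable $\Sigma\subseteq\Omega$, and (2) $\tau_1^*=\frac12(m_0^*+m_1^* )$ with $m_0^*={\rm mean}_f(\Omega\setminus\Sigma_1^* )$, $m_1^*={\rm mean}_f(\Sigma_1^* )$. The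 two-phase piecewise constant Mumford–Shah (Chan–Vese) functional with parameter $\lambda$ is $$E_{\rm CV}(\Sigma,m_0,m_1)={\rm Per}(\Sigma;\Omega)+\lambda\Big(\int_\Sigma(m_1-f)^2dx+\int_{\Omega\setminus\Sigma}(m_0-f)^2dx\Big).$$ A triple $(\Sigma^*,m_0^*,m_1^* )$ is a partial minimizer of $E_{\rm CV}$ if $E_{\rm CV}(\Sigma^*,m_0^*,m_1^* )\le E_{\rm CV}(\Sigma^*,m_0,m_1)$ for all $m_0,m_1$ and $E_{\rm CV}(\Sigma^*,m_0^*,m_1^* )\le E_{\rm CV}(\Sigma,m_0^*,m_1^* )$ for all measurable $\Sigma\subseteq\Omega$. *)

(* Defs.v *)
From HB Require Import structures.
From mathcomp Require Import all_boot all_order all_algebra.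
From mathcomp Require Import all_classical all_reals all_analysis.

Set Implicit Arguments.
Unset Strict Implicit.
Unset Printing Implicit Defensive.
Import Order.TTheory GRing.Theory Num.Theory.
Import numFieldNormedType.Exports.

Local Open Scope classical_set_scope.
Local Open Scope ring_scope.

Section LebesguePlane.
Context {R : realType}.

(* [lebesgue2] is the completion of the product of two (Borel) Lebesgue
   measures, so that its domain consists of all Lebesgue measurable sets;
   [plane] is [R * R] equipped with this sigma-algebra. *)
Definition lebesgue2 :=
  @completed_measure_extension _ _ _
    ((@lebesgue_measure R) \x (@lebesgue_measure R))%E.

HB.instance Definition _ := Measure.on lebesgue2.

Definition plane : measurableType _ :=
  caratheodory_type (((@lebesgue_measure R) \x (@lebesgue_measure R))%E^*)%mu.

End LebesguePlane.
Arguments plane R : clear implicits.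

Section Domain.
Context {R : realType}.
Implicit Type Omega : set (R * R).

(* Near each boundary point p, in the orthonormal frame (c, s), (- s, c)
   centred at p, Omega is the strict epigraph of a Lipschitz function. *)
Definition lipschitz_boundary Omega :=
  forall p : R * R, (closure Omega `\` interior Omega) p ->
  exists (c s r h : R) (g : R -> R),
    [/\ c ^+ 2 + s ^+ 2 = 1, 0 < r, 0 < h, lipschitz g &
      forall a b : R, `|a| < r -> `|b| < h ->
        (Omega (p + a *: (c, s) + b *: (- s, c)) <-> g a < b)].

Definition bounded_lipschitz_domain Omega :=
  [/\ open Omega, bounded_set Omega & lipschitz_boundary Omega].

End Domain.

Section TotalVariation.
Context {R : realType}.
Implicit Types (Omega : set (R * R)) (phi : R * R -> R * R).

Definition divergence phi (x : R * R) : R :=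
  'D_(1, 0) (fun y => (phi y).1) x + 'D_(0, 1) (fun y => (phi y).2) x.

Definition C1 phi :=
  (forall x, differentiable phi x) /\ (forall v, continuous ('D_v phi)).

(* A field in C_c^1(Omega, R^2) is identified with its extension by zero. *)
Definition C1c Omega phi :=
  [/\ C1 phi, compact (closure [set x | phi x != 0]) &
      closure [set x | phi x != 0] `<=` Omega].

(* The norm of [R * R] in the library is the max norm, whence the explicit
   Euclidean norm. *)
Definition unit_test_field Omega phi :=
  C1c Omega phi /\
  forall x, Num.sqrt ((phi x).1 ^+ 2 + (phi x).2 ^+ 2) <= 1.

Definition TV Omega (u : R * R -> R) : \bar R :=
  ereal_sup [set (\int[lebesgue2]_(x in Omega) (u x * divergence phi x)%:E)%E
            | phi in unit_test_field Omega].

Definition Per (A Omega : set (R * R)) : \bar R := TV Omega \1_A.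

End TotalVariation.

Section Models.
Context {R : realType}.
Implicit Types (Omega Sigma A : set (R * R)) (f : R * R -> R).

Definition image_on Omega f :=
  measurable_fun (Omega : set (plane R)) (f : plane R -> R) /\
  forall x, Omega x -> 0 <= f x <= 1.

Definition measurable_subset Omega Sigma :=
  measurable (Sigma : set (plane R)) /\ Sigma `<=` Omega.

Definition mean f A : R :=
  if (0 < lebesgue2 A)%E
  then (fine (lebesgue2 A))^-1 * \int[lebesgue2]_(x in A) f x else 0.

Definition TROF_energy Omega f (mu tau : R) Sigma : \bar R :=
  (Per Sigma Omega +
   (mu * \int[lebesgue2]_(x in Sigma) (tau - f x))%R%:E)%E.

Definition TROF_solution Omega f (mu : R) Sigma (tau : R) :=
  [/\ measurable_subset Omega Sigma,
      0 < tau < 1,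
      forall S, measurable_subset Omega S ->
        (TROF_energy Omega f mu tau Sigma <= TROF_energy Omega f mu tau S)%E &
      tau = 2^-1 * (mean f (Omega `\` Sigma) + mean f Sigma)].

Definition E_CV Omega f (lambda : R) Sigma (m0 m1 : R) : \bar R :=
  (Per Sigma Omega +
   (lambda * (\int[lebesgue2]_(x in Sigma) (m1 - f x) ^+ 2 +
              \int[lebesgue2]_(x in Omega `\` Sigma) (m0 - f x) ^+ 2))%R%:E)%E.

Definition CV_partial_minimizer Omega f (lambda : R) Sigma (m0 m1 : R) :=
  [/\ measurable_subset Omega Sigma,
      forall n0 n1 : R,
        (E_CV Omega f lambda Sigma m0 m1 <= E_CV Omega f lambda Sigma n0 n1)%E &
      forall S, measurable_subset Omega S ->
        (E_CV Omega f lambda Sigma m0 m1 <= E_CV Omega f lambda S m0 m1)%E].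

End Models.

(* Main.v *)
Require Import Defs.
From mathcomp Require Import all_boot all_order all_algebra.
From mathcomp Require Import all_classical all_reals all_analysis.
From mathcomp Require Import measurable_realfun ring lra.
Import Order.TTheory GRing.Theory Num.Theory.
Import numFieldNormedType.Exports.
Local Open Scope classical_set_scope.
Local Open Scope ring_scope.

(* Since (m1 - f)^2 - (m0 - f)^2 = 2 (m1 - m0) (tau - f) for
   tau = (m0 + m1) / 2, the Chan-Vese energy with parameter
   mu / (2 (m1 - m0)) and the T-ROF energy differ by a constant independent of
   the set. Comparing with the empty set in the T-ROF problem gives
   tau <= m1, hence m0 <= m1 and a nonnegative parameter, so that the means
   are optimal for the fidelity terms. *)

(** * Integrability and quadratic expansions on a set of finite measure *)

Lemma integrable_unit d (T : measurableType d) (R : realType)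
    (nu : {measure set T -> \bar R}) (D : set T) (f : T -> R) :
    measurable D -> (nu D < +oo)%E -> measurable_fun D f ->
    (forall x, D x -> 0 <= f x <= 1) ->
  nu.-integrable D (EFin \o f).
Proof.
move=> mD fD mf f01; apply: measurable_bounded_integrable => //.
exists 1; split=> // M M1 x /= /f01 /andP[f0 f1].
by rewrite ger0_norm// (le_trans f1)// ltW.
Qed.

Section QuadraticIntegrals.
Context d (T : measurableType d) (R : realType).
Variables (nu : {measure set T -> \bar R}) (D : set T) (f : T -> R).
Hypotheses (mD : measurable D) (fD : (nu D < +oo)%E).
Hypotheses (mf : measurable_fun D f) (f01 : forall x, D x -> 0 <= f x <= 1).

Lemma integrable_unit_sqr : nu.-integrable D (EFin \o (fun x => f x ^+ 2)).
Proof.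
apply: integrable_unit => //; first exact: (measurable_funX 2 mf).
by move=> x /f01 /andP[f0 f1]; rewrite exprn_ge0// exprn_ile1.
Qed.

Let intf : nu.-integrable D (EFin \o f).
Proof. exact: integrable_unit. Qed.

Let intc (c : R) : nu.-integrable D (EFin \o (fun=> c)).
Proof.
apply: measurable_bounded_integrable => //; exists `|c|; split=> // M cM x _ /=.
exact: ltW.
Qed.

Lemma Rintegral_cstB (c : R) :
  \int[nu]_(x in D) (c - f x) = c * fine (nu D) - \int[nu]_(x in D) f x.
Proof. by rewrite RintegralB// Rintegral_cst. Qed.

Lemma Rintegral_sqr_cstB (c : R) :
  \int[nu]_(x in D) (c - f x) ^+ 2 = c ^+ 2 * fine (nu D) -
    (2 * c) * (\int[nu]_(x in D) f x) + \int[nu]_(x in D) f x ^+ 2.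
Proof.
have i2 : nu.-integrable D (EFin \o (fun x => (2 * c) * f x)).
  exact: (integrableZl mD (2 * c) intf).
(* The right-hand side is gathered into a single integral, so that only the pointwise expansion of
   the square remains. *)
rewrite -Rintegral_cst// -RintegralZl// -RintegralB// -RintegralD//.
- by apply: eq_Rintegral => x _; ring.
- exact: (integrableB mD (intc _) i2).
- exact: integrable_unit_sqr.
Qed.

End QuadraticIntegrals.

(** * Measurability and area in the plane; sign of the perimeter *)

Section Plane.
Context {R : realType}.
Implicit Types (Omega S : set (R * R)) (f : R * R -> R).

(** Every point of an open set lies in a product of two balls with rational centres and radii that
    stays inside the set. The index set is countable, and products not contained in [Omega] are
    replaced by [set0]; this reduces measurability of [Omega] to that of rectangles. *)
Lemma open_bigcup_rat_rectangles {Omega} : open Omega ->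
  let B (q : rat * rat) : set R := ball (ratr q.1 : R) (ratr q.2) in
  Omega = \bigcup_p (if pselect (B p.1 `*` B p.2 `<=` Omega)
                     then B p.1 `*` B p.2 else set0).
Proof.
move=> oO B; apply/seteqP; split => [[x y] Oxy|z [p _]]; last first.
  by case: pselect => [h /h|_ []].
have /= [[U V] /= [Ux Vy] UV] : nbhs (x, y) Omega by exact: open_nbhs_nbhs.
(* [U] and [V] are only neighbourhoods, so rational balls are sought in their interiors. *)
have {}Ux : x \in (U^° : set R) by apply/mem_set.
have {}Vy : y \in (V^° : set R) by apply/mem_set.
have [a [r /= [xa aU]]] := open_subball_rat (@open_interior _ U) Ux.
have [b [s /= [yb bV]]] := open_subball_rat (@open_interior _ V) Vy.
exists ((a, r), (b, s)) => //; case: pselect => [?|].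
  by split; exact: set_mem.
case=> z [/= /aU /interior_subset Uz /bV /interior_subset Vz].
exact: UV.
Qed.

Lemma borel_plane_measurable (A : set (R * R)) :
  measurable (A : set (measurableTypeR R * measurableTypeR R)) ->
  measurable (A : set (plane R)).
Proof. by move=> mA; apply: sub_caratheodory; exact: sub_sigma_algebra. Qed.

Lemma open_plane_measurable Omega : open Omega ->
  measurable (Omega : set (plane R)).
Proof.
move=> oO; apply: borel_plane_measurable; rewrite (open_bigcup_rat_rectangles oO).
apply: countable_bigcupT_measurable => // p.
case: pselect => [?|?]; last exact: measurable0.
by apply: (@measurableX _ _ (measurableTypeR R) (measurableTypeR R));
  exact: measurable_ball.
Qed.

(** The set sits in a square, on which the completed measure agrees with the product measure. *)
Lemma bounded_plane_lt_pinfty Omega : bounded_set Omega ->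
  (lebesgue2 Omega < +oo)%E.
Proof.
move=> -[M [_ /(_ (`|M| + 1))]].
rewrite (le_lt_trans (ler_norm M)) ?ltrDl// => /(_ isT) OM.
(* Points of [Omega] have max norm at most [|M| + 1]; the extra 1 places them in the open balls of
   radius [r]. *)
set r := `|M| + 2; have r0 : 0 <= r by rewrite addr_ge0.
have OB : Omega `<=` ball (0 : R) r `*` ball (0 : R) r.
  move=> [x y] /OM /=; rewrite prod_normE /= ge_max => /andP[xM yM].
  by split; rewrite /ball /= sub0r normrN /r; lra.
apply: (@le_lt_trans _ _ (lebesgue2 (ball (0 : R) r `*` ball (0 : R) r))).
  exact: le_mu_ext.
have mB : measurable (ball (0 : R) r : set (measurableTypeR R)).
  exact: measurable_ball.
have -> : lebesgue2 (ball (0 : R) r `*` ball (0 : R) r) =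
    (lebesgue_measure \x lebesgue_measure)%E (ball (0 : R) r `*` ball (0 : R) r).
  apply: measurable_mu_extE; exact: measurableX.
by rewrite product_measure1E// [X in (X * _)%E]lebesgue_measure_ball//
  [X in (_ * X)%E]lebesgue_measure_ball// -EFinM ltry.
Qed.

Lemma C1c0 Omega : C1c Omega (cst 0).
Proof.
have supp0 : closure [set x : R * R | (cst 0 : R * R -> R * R) x != 0] = set0.
  rewrite (_ : [set x | _] = set0) ?closure0//.
  by apply/seteqP; split=> // x /=; rewrite eqxx.
split; last 2 first.
- by rewrite supp0; exact: compact0.
- by rewrite supp0.
split=> [x|v]; first exact: differentiable_cst.
rewrite (_ : 'D_v _ = cst 0); first exact: cst_continuous.
by apply/funext => x; rewrite derive_cst.
Qed.

(** The zero field is admissible and contributes 0 to the supremum. *)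
Lemma Per_ge0 S Omega : (0 <= Per S Omega)%E.
Proof.
apply: ereal_sup_ubound; exists (cst 0).
  split; first exact: C1c0.
  by move=> x /=; rewrite expr0n/= addr0 sqrtr0.
rewrite [LHS]integral0_eq// => x _.
by rewrite /divergence /= !derive_cst addr0 mulr0.
Qed.

Lemma Per_set0 Omega : Per set0 Omega = 0%E.
Proof.
apply/eqP; rewrite eq_le Per_ge0 andbT; apply: ge_ereal_sup => _ [phi _ <-].
by rewrite integral0_eq// => x _; rewrite indic0 mul0r.
Qed.

End Plane.

(** * The two energies in terms of areas, masses and second moments *)

Section Energies.
Context {R : realType}.
Variables (Omega : set (R * R)) (f : R * R -> R).
Hypotheses (hOmega : bounded_lipschitz_domain Omega) (hf : image_on Omega f).
Implicit Types (S : set (R * R)) (c : R).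

Let area S : R := fine (lebesgue2 S).

Let mass S : R := \int[lebesgue2]_(x in S) f x.

Let mass2 S : R := \int[lebesgue2]_(x in S) f x ^+ 2.

Let mOmega : measurable (Omega : set (plane R)).
Proof. by case: hOmega => oO _ _; exact: open_plane_measurable. Qed.

Lemma measurable_subset_lt_pinfty {S} : measurable_subset Omega S ->
  (lebesgue2 S < +oo)%E.
Proof.
move=> [_ SO]; case: hOmega => _ /bounded_plane_lt_pinfty bO _.
by apply: le_lt_trans bO; exact: le_mu_ext.
Qed.

Lemma measurable_fun_subset {S} : measurable_subset Omega S ->
  measurable_fun (S : set (plane R)) (f : plane R -> R).
Proof. by move=> [mS SO]; exact: (measurable_funS mOmega SO hf.1). Qed.

Lemma unit_subset {S} : measurable_subset Omega S ->
  forall x, S x -> 0 <= f x <= 1.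
Proof. by move=> [_ SO] x /SO; exact: hf.2. Qed.

Lemma measurable_subsetD {S} : measurable_subset Omega S ->
  measurable_subset Omega (Omega `\` S).
Proof. by move=> [mS SO]; split; [exact: measurableD|exact: subDsetl]. Qed.

Lemma measurable_subset0 : measurable_subset Omega set0.
Proof. by split; [exact: (@measurable0 _ (plane R))|exact: sub0set]. Qed.

Lemma measurable_subset_full : measurable_subset Omega Omega.
Proof. by split. Qed.

Lemma Rintegral_fidelity1 S c : measurable_subset Omega S ->
  \int[lebesgue2]_(x in S) (c - f x) = c * area S - mass S.
Proof.
move=> hS; have [mS _] := hS.
apply: (@Rintegral_cstB _ (plane R)) => //.
- exact: measurable_subset_lt_pinfty.
- exact: measurable_fun_subset.
- exact: unit_subset.
Qed.

Lemma Rintegral_fidelity2 S c : measurable_subset Omega S ->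
  \int[lebesgue2]_(x in S) (c - f x) ^+ 2 =
    c ^+ 2 * area S - (2 * c) * mass S + mass2 S.
Proof.
move=> hS; have [mS _] := hS.
apply: (@Rintegral_sqr_cstB _ (plane R)) => //.
- exact: measurable_subset_lt_pinfty.
- exact: measurable_fun_subset.
- exact: unit_subset.
Qed.

(** For a null set, the mean is 0 by convention and the mass vanishes as well. *)
Lemma mean_area S : measurable_subset Omega S -> mean f S * area S = mass S.
Proof.
move=> hS; have [mS _] := hS; rewrite /mean; case: ifPn => [S0|].
  rewrite mulrAC mulVf ?mul1r// gt_eqF// fine_gt0// S0/=.
  exact: measurable_subset_lt_pinfty.
rewrite -leNgt => S0; rewrite mul0r /mass /Rintegral.
rewrite (@null_set_integral _ (plane R))//.
- by apply/measurable_EFinP; exact: measurable_fun_subset.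
- by apply/eqP; rewrite eq_le S0 measure_ge0.
Qed.

Lemma E_CV_areaE S (lambda m0 m1 : R) : measurable_subset Omega S ->
  E_CV Omega f lambda S m0 m1 = (Per S Omega + (lambda *
    ((m1 ^+ 2 * area S - (2 * m1) * mass S + mass2 S) +
     (m0 ^+ 2 * area (Omega `\` S) - (2 * m0) * mass (Omega `\` S) +
      mass2 (Omega `\` S))))%:E)%E.
Proof.
move=> hS; rewrite /E_CV !Rintegral_fidelity2//; exact: measurable_subsetD.
Qed.

Lemma area_setD S : measurable_subset Omega S ->
  area (Omega `\` S) = area Omega - area S.
Proof.
move=> hS; have [mS SO] := hS.
have fin A : measurable_subset Omega A -> lebesgue2 A \is a fin_num.
  by move=> hA; rewrite ge0_fin_numE// measurable_subset_lt_pinfty.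
rewrite /area (@measureD _ (plane R))//; last first.
  exact: measurable_subset_lt_pinfty measurable_subset_full.
by rewrite setIidr// fineB// fin//; exact: measurable_subset_full.
Qed.

Lemma RintegralD_setD (g : R * R -> R) S : measurable_subset Omega S ->
    (@lebesgue2 R).-integrable Omega (EFin \o g) ->
  \int[lebesgue2]_(x in Omega `\` S) g x =
  \int[lebesgue2]_(x in Omega) g x - \int[lebesgue2]_(x in S) g x.
Proof.
move=> hS ig; have [mS SO] := hS; have [mD _] := measurable_subsetD hS.
rewrite -{2}(setDUK SO) (@Rintegral_setU _ (plane R))// ?setDUK//.
  by rewrite addrAC subrr add0r.
by apply/disj_setPS; rewrite setDIK.
Qed.

(** The additive constant is the Chan-Vese energy of the empty set: the weighted fidelity of [m0] on
    all of [Omega]. *)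
Lemma E_CV_TROF_energyE S (mu m0 m1 : R) : measurable_subset Omega S ->
  m0 != m1 ->
  E_CV Omega f (mu / (2 * (m1 - m0))) S m0 m1 =
  (TROF_energy Omega f mu (2^-1 * (m0 + m1)) S +
   (mu / (2 * (m1 - m0)) *
    \int[lebesgue2]_(x in Omega) (m0 - f x) ^+ 2)%:E)%E.
Proof.
move=> hS m01; rewrite E_CV_areaE// /TROF_energy Rintegral_fidelity1//.
rewrite (Rintegral_fidelity2 _ _ measurable_subset_full).
have iO : (@lebesgue2 R).-integrable Omega (EFin \o f).
  apply: (@integrable_unit _ (plane R)) => //; last exact: hf.2.
    exact: measurable_subset_lt_pinfty measurable_subset_full.
  exact: hf.1.
have iO2 : (@lebesgue2 R).-integrable Omega (EFin \o (fun x => f x ^+ 2)).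
  apply: (@integrable_unit_sqr _ (plane R)) => //; last exact: hf.2.
    exact: measurable_subset_lt_pinfty measurable_subset_full.
  exact: hf.1.
(* Integrals over the complement become differences of integrals over [Omega] and [S]; what is left
   is a rational identity with denominator [2 * (m1 - m0)]. *)
rewrite area_setD// /mass /mass2 !(RintegralD_setD _ _ hS)// -addeA -EFinD.
congr (_ + _%:E)%E; field.
by rewrite subr_eq0 eq_sym m01.
Qed.

(** Writing the mass as mean times area, the second moments cancel and the two sides differ by the
    area times [(c - mean f S) ^+ 2]. *)
Lemma mean_minimizes_fidelity S c : measurable_subset Omega S ->
  \int[lebesgue2]_(x in S) (mean f S - f x) ^+ 2 <=
  \int[lebesgue2]_(x in S) (c - f x) ^+ 2.
Proof.
move=> hS; rewrite !Rintegral_fidelity2// -subr_ge0 -mean_area//.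
rewrite [leRHS](_ : _ = area S * (c - mean f S) ^+ 2); last by ring.
by rewrite mulr_ge0 ?sqr_ge0// fine_ge0.
Qed.

End Energies.

(** * Partial minimality of T-ROF solutions *)

Theorem theorem3p4 (R : realType) (Omega : set (R * R)) (f : R * R -> R)
  (hOmega : bounded_lipschitz_domain Omega) (hf : image_on Omega f)
  (mu : R) (hmu : 0 < mu) (Sigma1 : set (R * R)) (tau1 : R)
  (hsol : TROF_solution Omega f mu Sigma1 tau1)
  (hSigma1 : (0 < lebesgue2 Sigma1 < lebesgue2 Omega)%E) :
  let m0 := mean f (Omega `\` Sigma1) in
  let m1 := mean f Sigma1 in
  let lambda := mu / (2 * (m1 - m0)) in
  CV_partial_minimizer Omega f lambda Sigma1 m0 m1.
Proof.
move=> m0 m1 lambda; case: hsol => hS _ minS tauE.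
have := minS _ (measurable_subset0 Omega).
rewrite /TROF_energy Rintegral_set0 mulr0 adde0 Per_set0 => PerS.
have aS0 : 0 < fine (lebesgue2 Sigma1).
  rewrite fine_gt0// (measurable_subset_lt_pinfty _ hOmega hS) andbT.
  by case/andP: hSigma1.
have m01 : m0 <= m1.
  (* Dropping the nonnegative perimeter from [PerS] leaves [mu * (tau1 - m1) * |Sigma1| <= 0]; both
     factors [mu] and [|Sigma1|] are positive, and [tau1] is the midpoint of [m0] and [m1]. *)
  have /le_trans/(_ PerS) := leeDr
    (mu * \int[lebesgue2]_(x in Sigma1) (tau1 - f x))%:E (Per_ge0 Sigma1 Omega).
  rewrite lee_fin pmulr_rle0// (Rintegral_fidelity1 _ _ hOmega hf _ _ hS).
  rewrite -(mean_area _ _ hOmega hf _ hS) -mulrBl pmulr_lle0// tauE -/m0 -/m1; lra.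
have lambda0 : 0 <= lambda.
  by rewrite divr_ge0 ?mulr_ge0 ?subr_ge0// ltW.
split => // [n0 n1|S hS'].
  (* The perimeter is common to both sides, and each mean is optimal on its own phase. *)
  apply: leeD2l; rewrite lee_fin ler_wpM2l// lerD//.
    exact: (mean_minimizes_fidelity _ _ hOmega hf).
  apply: (mean_minimizes_fidelity _ _ hOmega hf).
  exact: measurable_subsetD.
have [m0E|m0Nm1] := eqVneq m0 m1; last first.
  (* For distinct means the same constant appears on both sides, and the midpoint is the threshold
     [tau1]. *)
  by rewrite /lambda !(E_CV_TROF_energyE _ _ hOmega hf)// leeD2r// -tauE; exact: minS.
(* Here [lambda] is [mu / 0 = 0], so that both energies are perimeters; the
   comparison with the empty set forces the perimeter of [Sigma1] to vanish. *)
have lam0 : lambda = 0 by rewrite /lambda m0E subrr mulr0 invr0 mulr0.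
rewrite /E_CV lam0 !mul0r !adde0; apply: le_trans (Per_ge0 S Omega).
(* With equal means the threshold is [m1], so the fidelity term in [PerS], a multiple of
   [tau1 - m1], is zero. *)
have tau1E : tau1 = m1 by rewrite tauE -/m0 -/m1 m0E; lra.
move: PerS; rewrite (Rintegral_fidelity1 _ _ hOmega hf _ _ hS).
by rewrite -(mean_area _ _ hOmega hf _ hS) tau1E subrr mulr0 adde0.
Qed.
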